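(* Assume that (i) for every group $g\in\mathcal G$, $U_g(t_g^{\max})\ge U_g^\star>0$; (ii) there exists $\gamma>0$ such that the propensities satisfy $p^{\sigma_{q,g}^f(j)}>\gamma$ for all $g\in\mathcal G$, all $q\in\mathcal Q$ (and all relevance vectors), and all $j\in\{1,\dots,t_g^{\max}\}$; and (iii) $U_g$ is strictly increasing. Let the clipping parameter be $\lambda=\sqrt m$, where $m$ is the number of logged requests, and let $\hat t_g$ be either $\hat t_g^{\mathrm{union}}$ or $\hat t_g^{\mathrm{mono}}$ (both computed, for each $m$, from the first $m$ logged requests with the lower bound $\hat U_g^-$ given in the context). Let $$t_g^\star:=\min\{t\in\{1,\dots,t_g^{\max}\}:U_g(t)\ge U_g^\star\}.$$ Then for any group $g\in\mathcal G$ and any $\alpha\in(0,1)$, it holds almost surely that there exists $c>0$ such that for any $m>c$, $$t_g^\star\le\hat t_g\le t_g^\star+1 .$$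
   Context: There are $n$ items $d^1,\dots,d^n$ in an item space $\mathcal D$, and a family $\mathcal G$ of (possibly overlapping) groups of items. A recommendation request is a pair $(q,\mathbf r)$ drawn from a distribution $P_{Q,\mathbf R}$, where $q\in\mathcal Q$ is a query and $\mathbf r=(r^1,\dots,r^n)\in\{0,1\}^n$ is the vector of relevances of the items. A relevance model $f:\mathcal Q\times\mathcal D\to[0,1]$ is fixed. For a query $q$ and group $g$, $\sigma_{q,g}^f$ is a deterministic ranking of the items of $g$ by decreasing value of $f(q,\cdot)$; $\sigma_{q,g}^f(j)$ is the index of the item of $g$ ranked at position $j$. For each $g$, $t_g^{\max}$ is a positive integer (at most the number of items in $g$) and $U_g^\star\in\mathbb R$ is a target. The function $U_g$ is defined for $t\in\{0,1,\dots,t_g^{\max}\}$ by $$U_g(t):=\mathbb E_{(q,\mathbf r)\sim P_{Q,\mathbf R}}\Big[\sum_{j=1}^{t} r^{\sigma_{q,g}^f(j)}\Big].$$ Logged data: for a fixed logging policy $\pi_0$, for each $i=1,2,\dots$, independently, $(Q_i,\mathbf R_i)\sim P_{Q,\mathbf R}$, and a user observation vector $\mathbf O_i\in\{0,1\}^n$ is drawn from a conditional distribution $P^{\pi_0}_{\mathbf O\mid Q,\mathbf R}$ given $(Q_i,\mathbf R_i)$ (the same for all $i$). The user feedback on item $j$ is $C_i^j=O_i^jR_i^j$. The propensity is $p_i^j:=\Pr(O_i^j=1\mid Q_i,\mathbf R_i;\pi_0)$, a function of $(Q_i,\mathbf R_i)$ which is assumed known; $p^j$ denotes the propensity of item $j$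 for a generic request. For $m>1$, $\lambda>0$, put $$Z_i^{g,t}=\sum_{j=1}^t\min\Big(\lambda,\frac1{p_i^{\sigma_{Q_i,g}^f(j)}}\Big)C_i^{\sigma_{Q_i,g}^f(j)},\qquad \hat U_{g,\lambda}^{\mathrm{CIPW}}(t)=\frac1m\sum_{i=1}^m Z_i^{g,t},$$ $$V_m(\mathbf Z^{g,t})=\frac1{m(m-1)}\sum_{1\le i<j\le m}\big(Z_i^{g,t}-Z_j^{g,t}\big)^2,$$ $$\hat U_g^-(t,\alpha)=\hat U_{g,\lambda}^{\mathrm{CIPW}}(t)-\sqrt{\frac{2V_m(\mathbf Z^{g,t})\ln(2/\alpha)}{m}}-\frac{7t\lambda\ln(2/\alpha)}{3(m-1)} .$$ Threshold selection rules (minimum over the empty set is defined to be $t_g^{\max}$): $$\hat t_g^{\mathrm{union}} := \min\Big\{t\in\{1,\dots,t_g^{\max}-1\} : \hat U_g^-\Big(t,\tfrac{\alpha}{t_g^{\max}-1}\Big)\ge U_g^\star\Big\},$$ $$\hat t_g^{\mathrm{mono}} := \min\Big\{t\in\{1,\dots,t_g^{\max}-1\} : \hat U_g^-(t',\alpha)\ge U_g^\star \ \text{ for all integers } t\le t'<t_g^{\max}\Big\}.$$ *)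

(* Defs.v *)
From HB Require Import structures.
From mathcomp Require Export all_boot all_order all_algebra.
From mathcomp Require Export all_classical all_reals all_analysis.
Set Implicit Arguments.
Unset Strict Implicit.
Unset Printing Implicit Defensive.
Import Order.TTheory GRing.Theory Num.Theory.
Local Open Scope classical_set_scope.
Local Open Scope ring_scope.

(* Items are represented by their indices in 'I_n and a group of items by a
   {set 'I_n}. A vector of {0,1}^n is an n.-tuple bool, whose product
   sigma-algebra is the discrete one. A request is a pair
   x = (q, r) : Q * n.-tuple bool. A ranking s : nat -> 'I_n of a group A is
   meaningful on the positions 1, ..., #|A| only. *)

Definition is_ranking (R : realType) (n : nat) (score : 'I_n -> R)
    (A : {set 'I_n}) (s : nat -> 'I_n) : Prop :=
  let l := [seq s j | j <- index_iota 1 #|A|.+1] in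
  perm_eq l (enum A) /\ sorted (fun i i' => score i' <= score i) l.

Definition utility (R : realType) (n : nat) (dQ : measure_display)
    (Q : measurableType dQ) (PQR : probability (Q * n.-tuple bool)%type R)
    (s : Q -> nat -> 'I_n) (t : nat) : R :=
  fine (expectation PQR (fun x : Q * n.-tuple bool =>
                 \sum_(1 <= j < t.+1) (tnth x.2 (s x.1 j) : nat)%:R)).

(* Mutual independence of a family of random elements: the product rule holds
   for every finite subfamily. *)
Definition mutually_independent (R : realType) (d d' : measure_display)
    (Omega : measurableType d) (T : measurableType d')
    (P : probability Omega R) (I : choiceType) (X : I -> Omega -> T) : Prop :=
  forall (J : seq I) (A : I -> set T), uniq J ->
    (forall i, measurable (A i)) ->
    (P (\bigcap_(i in [set` J]) (X i @^-1` A i)) =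
     \prod_(i <- J) P (X i @^-1` A i))%E.

(* [X i] is the i-th request (Q_i, R_i) and [O i] the i-th observation vector,
   numbered from 0. The third clause says that X i has law PQR and that K is the
   conditional law of O i given X i. *)
Definition logged_data (R : realType) (n : nat) (dQ d : measure_display)
    (Q : measurableType dQ) (Omega : measurableType d)
    (PQR : probability (Q * n.-tuple bool)%type R)
    (K : R.-pker (Q * n.-tuple bool)%type ~> n.-tuple bool)
    (P : probability Omega R)
    (X : nat -> Omega -> Q * n.-tuple bool)
    (O : nat -> Omega -> n.-tuple bool) : Prop :=
  [/\ forall i, measurable_fun [set: Omega] (X i),
      forall i, measurable_fun [set: Omega] (O i),
      forall i (A : set (Q * n.-tuple bool)) (B : set (n.-tuple bool)),
        measurable A -> measurable B ->
        (P (X i @^-1` A `&` O i @^-1` B) = \int[PQR]_(x in A) K x B)%E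
    & mutually_independent P (fun i w => (X i w, O i w))].

Definition propensity (R : realType) (n : nat) (dQ : measure_display)
    (Q : measurableType dQ)
    (K : R.-pker (Q * n.-tuple bool)%type ~> n.-tuple bool)
    (x : Q * n.-tuple bool) (j : 'I_n) : R :=
  fine (K x [set o : n.-tuple bool | tnth o j]).

Definition feedback (R : realType) (n : nat) (o r : n.-tuple bool) (j : 'I_n) : R :=
  (tnth o j : nat)%:R * (tnth r j : nat)%:R.

Definition clipped_term (R : realType) (n : nat) (dQ : measure_display)
    (Q : measurableType dQ)
    (K : R.-pker (Q * n.-tuple bool)%type ~> n.-tuple bool)
    (s : Q -> nat -> 'I_n) (lambda : R) (t : nat)
    (x : Q * n.-tuple bool) (o : n.-tuple bool) : R :=
  \sum_(1 <= j < t.+1)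
    Num.min lambda (1 / propensity K x (s x.1 j)) * feedback R o x.2 (s x.1 j).

Definition sample_mean (R : realType) (m : nat) (z : nat -> R) : R :=
  1 / m%:R * \sum_(i < m) z i.

Definition sample_variance (R : realType) (m : nat) (z : nat -> R) : R :=
  1 / (m%:R * (m%:R - 1)) *
  \sum_(j < m) \sum_(i < m | (i < j)%N) (z i - z j) ^+ 2.

Definition lower_bound (R : realType) (m : nat) (lambda : R) (z : nat -> R)
    (t : nat) (alpha : R) : R :=
  sample_mean m z
  - Num.sqrt (2 * sample_variance m z * ln (2 / alpha) / m%:R)
  - 7 * t%:R * lambda * ln (2 / alpha) / (3 * (m%:R - 1)).

(* The bound computed from the first m logged requests along one realization
   x, o of the log. *)
Definition CIPW_lower_bound (R : realType) (n : nat) (dQ : measure_display)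
    (Q : measurableType dQ)
    (K : R.-pker (Q * n.-tuple bool)%type ~> n.-tuple bool)
    (s : Q -> nat -> 'I_n) (lambda : R) (m : nat)
    (x : nat -> Q * n.-tuple bool) (o : nat -> n.-tuple bool)
    (t : nat) (alpha : R) : R :=
  lower_bound m lambda (fun i => clipped_term K s lambda t (x i) (o i)) t alpha.

(* Minimum of {t in {lo, ..., hi - 1} : p t}, or t0 if this set is empty. *)
Definition min_threshold (lo hi t0 : nat) (p : pred nat) : nat :=
  head t0 [seq t <- index_iota lo hi | p t].

(* [L] stands for (t, alpha) |-> hat U_g^-(t, alpha). *)
Definition t_union (R : realType) (tmax : nat) (Ustar : R) (L : nat -> R -> R)
    (alpha : R) : nat :=
  min_threshold 1 tmax tmax (fun t => Ustar <= L t (alpha / (tmax%:R - 1))).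

Definition t_mono (R : realType) (tmax : nat) (Ustar : R) (L : nat -> R -> R)
    (alpha : R) : nat :=
  min_threshold 1 tmax tmax
    (fun t => all (fun t' => Ustar <= L t' alpha) (index_iota t tmax)).

(* The default value is irrelevant when Ustar <= U tmax. *)
Definition t_star (R : realType) (tmax : nat) (Ustar : R) (U : nat -> R) : nat :=
  min_threshold 1 tmax.+1 tmax (fun t => Ustar <= U t).

(* Main.v *)
(* Once sqrt m >= 1 / gamma no term is clipped, so the summands are independent,
   bounded inverse-propensity weighted terms whose mean is U_g(t). By a strong
   law of large numbers their sample mean converges almost surely to U_g(t), and
   both penalties in the lower bound are O(1 / sqrt m); hence the lower bound
   converges to U_g(t) for all t simultaneously. Since U_g is strictly
   increasing, eventually every t < t_g^* fails the test and every
   t > t_g^* with t < t_g^max passes it; only the outcome at t_g^* (where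
   U_g may equal the target) is undetermined. *)
Require Import Defs.
From mathcomp Require Import measurable_realfun zify ring lra.
Set Implicit Arguments.
Unset Strict Implicit.
Unset Printing Implicit Defensive.
Import Order.TTheory GRing.Theory Num.Theory.
Import numFieldNormedType.Exports HBNNSimple.
Local Open Scope classical_set_scope.
Local Open Scope ring_scope.

(** * Strong law of large numbers for bounded orthogonal variables *)

Lemma sqr_bracket (m : nat) : exists k : nat, (k ^ 2 <= m < k.+1 ^ 2)%N.
Proof.
elim: m => [|m [k /andP[km mk]]]; first by exists 0%N.
have [mk1|mk1] := ltnP m.+1 (k.+1 ^ 2).
  by exists k; rewrite mk1 andbT (leq_trans km).
by exists k.+1; rewrite mk1/= (leq_ltn_trans mk)// ltn_sqr.
Qed.

Section bounded_slln.
Variable R : realType.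

(** Between two consecutive squares there are only O(k) terms, each bounded by [B], so the partial
    sum moves by O(k), which is negligible against [k ^ 2]. *)
Lemma cvg_mean_of_squares (y : R ^nat) (B : R) : (forall i, `|y i| <= B) ->
  (\sum_(i < k.+1 ^ 2) y i / (k.+1 ^ 2)%:R) @[k --> \oo] --> (0 : R) ->
  (\sum_(i < m) y i / m%:R) @[m --> \oo] --> (0 : R).
Proof.
move=> yB cvgS.
have B0 : 0 <= B by exact: le_trans (yB 0%N).
have diff a b : (a <= b)%N ->
    `|\sum_(i < b) y i| <= `|\sum_(i < a) y i| + B * (b - a)%:R.
  move=> ab; rewrite -!(big_mkord xpredT y) (big_cat_nat (n := a))//=.
  rewrite (le_trans (ler_normD _ _))// lerD2l.
  rewrite (le_trans (ler_norm_sum _ _ _))//.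
  rewrite (le_trans (ler_sum _ (fun i _ => yB i)))// big_const_nat iter_addr_0.
  by rewrite mulr_natr.
apply/cvgr0Pnorm_lt => e e0.
have e20 : 0 < e / 2 by rewrite divr_gt0.
have /cvgr0Pnorm_lt/(_ _ e20)[N1 _ N1P] := cvgS.
(* With [K > 4 * B / e] the gap contribution [2 * B * K] is below [e / 2 * K ^+ 2]; the sum up to
   the square contributes the other half. *)
have [N2 _ N2P] := @nbhs_infty_gtr R (4 * B / e).
exists ((N1 + N2).+2 ^ 2)%N => // m /= Nm.
have [[|k] /andP[km mk]] := sqr_bracket m.
  by have := leq_ltn_trans Nm mk; rewrite ltn_sqr.
have Nk : (N1 + N2 <= k)%N.
  by have := leq_ltn_trans Nm mk; rewrite ltn_sqr !ltnS => /ltnW.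
have := N1P k (leq_trans (leq_addr _ _) Nk).
have : 4 * B / e < k.+1%:R.
  by apply: N2P; rewrite /= (leq_trans (leq_addl N1 _))// (leq_trans Nk).
rewrite ltr_pdivrMr// -!mulr_suml !normrM !normfV !normr_nat.
set K : R := k.+1%:R => Be.
have K0 : 0 < K by rewrite ltr0n.
have -> : (k.+1 ^ 2)%:R = K ^+ 2 by rewrite natrX.
have Km : K ^+ 2 <= m%:R by rewrite -natrX ler_nat.
have m0 : 0 < m%:R :> R by rewrite (lt_le_trans _ Km)// exprn_gt0.
rewrite !ltr_pdivrMr ?exprn_gt0// => SK.
rewrite (le_lt_trans (diff _ _ km))//.
have -> : (m - k.+1 ^ 2)%:R = m%:R - K ^+ 2 :> R by rewrite natrB// natrX.
have mK : m%:R <= K ^+ 2 + 2 * K.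
  have : (m <= k.+1 ^ 2 + 2 * k.+1)%N by move: mk; rewrite !expnS !expn0; nia.
  by rewrite -(ler_nat R) natrD natrX natrM.
have : B * (m%:R - K ^+ 2) <= B * (2 * K) by rewrite ler_wpM2l// lerBlDl.
nra.
Qed.

Context d (T : measurableType d) (P : probability T R).

Lemma bounded_measurable_integrable (f : T -> R) (B : R) : measurable_fun setT f ->
  (forall x, `|f x| <= B) -> P.-integrable setT (EFin \o f).
Proof.
move=> mf fB; apply: measurable_bounded_integrable => //=.
  by rewrite ltey_eq fin_num_measure.
by exists B; split; rewrite ?num_real// => M BM x _; rewrite /= (le_trans (fB x))// ltW.
Qed.

(** Once the square is expanded, the cross terms integrate to 0 and each of the [m] diagonal terms
    contributes at most [B ^+ 2]. *)
Lemma orthogonal_sum_sq (Y : nat -> T -> R) (B : R) (m : nat) :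
  (forall i, measurable_fun setT (Y i)) -> (forall i w, `|Y i w| <= B) ->
  (forall i j, i != j -> \int[P]_w (Y i w * Y j w)%:E = 0)%E ->
  (\int[P]_w ((\sum_(i < m) Y i w) ^+ 2)%:E <= (m%:R * B ^+ 2)%:E)%E.
Proof.
move=> mY YB orth.
have YYB i j w : `|Y i w * Y j w| <= B ^+ 2.
  by rewrite normrM expr2 ler_pM.
have iYY i j : P.-integrable setT (EFin \o (fun w => Y i w * Y j w)).
  by apply: (@bounded_measurable_integrable _ (B ^+ 2)) => //; exact: measurable_funM.
under eq_integral.
  move=> w _; rewrite expr2 mulr_suml -sumEFin.
  under eq_bigr do rewrite mulr_sumr -sumEFin.
  over.
rewrite integral_sum//=; last by move=> i; apply: integrable_sum => // j _; exact: iYY.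
have -> : (m%:R * B ^+ 2)%:E = (\sum_(i < m) (B ^+ 2)%:E)%E.
  by rewrite sumEFin sumr_const card_ord mulr_natl.
apply: lee_sum => i _; rewrite integral_sum//=; last by move=> j; exact: iYY.
rewrite (bigD1 i)//= big1 ?adde0; last first.
  by move=> j ji; apply: orth; rewrite eq_sym.
rewrite (le_trans (y := (\int[P]_w (B ^+ 2)%:E)%E))//.
  apply: le_integral => //; first exact: iYY.
    exact: finite_measure_integrable_cst.
  by move=> w _; rewrite lee_fin (le_trans (ler_norm _))// YYB.
by rewrite integral_cst//= probability_setT mule1.
Qed.

(** Induction goes through for the sharper bound [2 - 1 / n], because
    [1 / (n + 1) ^ 2 <= 1 / n - 1 / (n + 1)]. *)
Lemma sum_inv_sq_le2 (n : nat) : \sum_(k < n) (k.+1%:R ^+ 2)^-1 <= 2 :> R.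
Proof.
suff: \sum_(k < n) (k.+1%:R ^+ 2)^-1 <= 2 - (if n is 0 then 0 else n%:R^-1) :> R.
  move=> /le_trans; apply; rewrite gerBl; case: n => // n; exact: invr_ge0.
elim: n => [|n IH]; first by rewrite big_ord0 subr0.
rewrite big_ord_recr/=; case: n IH => [|n] IH; first by rewrite big_ord0; lra.
rewrite (le_trans (lerD IH (lexx _)))//.
set a : R := n.+1%:R; have a0 : 0 < a by rewrite ltr0n.
have -> : n.+2%:R = a + 1 :> R by rewrite -natr1.
rewrite -subr_ge0.
have -> : 2 - (a + 1)^-1 - (2 - a^-1 + ((a + 1) ^+ 2)^-1) = (a * (a + 1) ^+ 2)^-1.
  by field; rewrite !gt_eqF//= addr_gt0.
by rewrite invr_ge0 mulr_ge0 ?sqr_ge0// ltW.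
Qed.

(* The squared means along the perfect squares have expectations at most
   B^2 / k^2, so their series is integrable and they tend to 0 almost surely;
   boundedness of the terms fills the gaps between consecutive squares. *)
Lemma bounded_orthogonal_slln (Y : nat -> T -> R) (B : R) :
  (forall i, measurable_fun setT (Y i)) -> (forall i w, `|Y i w| <= B) ->
  (forall i j, i != j -> \int[P]_w (Y i w * Y j w)%:E = 0)%E ->
  {ae P, forall w, (\sum_(i < m) Y i w / m%:R) @[m --> \oo] --> (0 : R)}.
Proof.
move=> mY YB orth.
pose S k w := \sum_(i < k.+1 ^ 2) Y i w / (k.+1 ^ 2)%:R.
pose A k w := ((S k w) ^+ 2)%:E.
have mS k : measurable_fun setT (S k).
  by apply: measurable_sum => i; apply: measurable_funM.
have mA k : measurable_fun setT (A k).
  by apply/measurable_EFinP; apply: measurable_funX.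
have A0 k w : (0 <= A k w)%E by rewrite lee_fin sqr_ge0.
have intA k : (\int[P]_w A k w <= (B ^+ 2 * (k.+1%:R ^+ 2)^-1)%:E)%E.
  have k0 : k.+1%:R != 0 :> R by rewrite pnatr_eq0.
  rewrite (eq_integral (fun w => (((k.+1%:R ^+ 4)^-1)%:E *
      ((\sum_(i < k.+1 ^ 2) Y i w) ^+ 2)%:E))%E); last first.
    move=> w _; rewrite -EFinM /A /S -mulr_suml exprMn natrX; congr EFin.
    by rewrite exprVn -exprM mulrC.
  rewrite ge0_integralZl//; last 2 first.
  - apply/measurable_EFinP; apply: measurable_funX.
    by apply: measurable_sum => i.
  - by move=> w _; rewrite lee_fin sqr_ge0.
  apply: (@le_trans _ _ (((k.+1%:R ^+ 4)^-1)%:E * ((k.+1 ^ 2)%:R * B ^+ 2)%:E)%E).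
    by apply: lee_wpmul2l; [rewrite lee_fin invr_ge0 exprn_ge0|exact: orthogonal_sum_sq].
  rewrite -EFinM lee_fin natrX le_eqVlt; apply/orP; left; apply/eqP.
  by field.
have sumA : P.-integrable setT (fun w => \sum_(k <oo) A k w)%E.
  apply/integrableP; split.
    by apply: ge0_emeasurable_sum.
  under eq_integral do rewrite gee0_abs ?nneseries_ge0//.
  rewrite integral_nneseries//.
  apply: (@le_lt_trans _ _ (B ^+ 2 * 2)%:E); last exact: ltry.
  apply: lime_le.
    by apply: is_cvg_nneseries => k _ _; exact: integral_ge0.
  apply: nearW => n; rewrite big_mkord.
  apply: le_trans; first by apply: lee_sum => i _; exact: intA.
  rewrite sumEFin lee_fin -mulr_sumr ler_wpM2l ?sqr_ge0//.
  exact: sum_inv_sq_le2.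
have := integrable_ae measurableT sumA.
apply: filterS => w /(_ Logic.I) fin.
apply: (@cvg_mean_of_squares (Y ^~ w) B) => //.
have cvg2 : (S k w ^+ 2) @[k --> \oo] --> (0 : R).
  apply: cvg_series_cvg_0; apply: nnseries_is_cvg.
    by move=> k; exact: sqr_ge0.
  move: fin; rewrite fin_numE => /andP[_].
  by rewrite -ltey.
apply/cvgr0Pnorm_lt => e e0.
have e2 : 0 < e ^+ 2 by rewrite exprn_gt0.
move/cvgr0Pnorm_lt: cvg2 => /(_ _ e2); apply: filterS => k.
by rewrite normrX ltr_pXn2r// nnegrE ?ltW.
Qed.

End bounded_slln.

(** * Integration against a measure with a density *)

Lemma ge0_integral_density (R : realType) d (T : measurableType d)
    (mu nu : {measure set T -> \bar R}) (phi : T -> R) (f : T -> \bar R) :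
  measurable_fun setT phi -> (forall x, 0 <= phi x) ->
  (forall A, measurable A -> nu A = \int[mu]_(x in A) (phi x)%:E)%E ->
  measurable_fun setT f -> (forall x, (0 <= f x)%E) ->
  (\int[nu]_x f x = \int[mu]_x (f x * (phi x)%:E))%E.
Proof.
move=> mphi phi0 nuE mf f0.
have mphiE : measurable_fun setT (EFin \o phi) by exact/measurable_EFinP.
(* Both sides are monotone limits along the simple functions [h n], and on the indicators that
   compose [h n] the claim is the density hypothesis. *)
pose h := nnsfun_approx measurableT mf.
have hf x : (EFin \o h n) x @[n --> \oo] --> f x by exact: cvg_nnsfun_approx.
have ndh x : {homo (fun n => (h n x)%:E) : a b / (a <= b)%N >-> (a <= b)%E}.
  by move=> a b ab; rewrite lee_fin; exact/lefP/nd_nnsfun_approx.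
have -> : (\int[nu]_x f x = limn (fun n => \int[nu]_x (h n x)%:E))%E.
  rewrite -monotone_convergence//.
  - by apply: eq_integral => x _; apply/esym/cvg_lim => //; exact: hf.
  - by move=> n; exact/measurable_EFinP.
  - by move=> n x _; rewrite lee_fin.
have -> : (\int[mu]_x (f x * (phi x)%:E) =
    limn (fun n => \int[mu]_x ((h n x)%:E * (phi x)%:E)))%E.
  rewrite -monotone_convergence//.
  - by apply: eq_integral => x _; apply/esym/cvg_lim => //; apply: cvgeZr => //; exact: hf.
  - by move=> n; apply: emeasurable_funM => //; exact/measurable_EFinP.
  - by move=> n x _; rewrite mule_ge0// lee_fin.
  - by move=> x _ a b ab; rewrite lee_wpmul2r ?lee_fin//; exact: ndh.
congr (limn _); apply/funext => n.
have hE x : (h n x)%:E = (\sum_(y \in range (h n)) (y * \1_(h n @^-1` [set y]) x)%:E)%E.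
  by rewrite fimfunE -fsumEFin.
have mind r : measurable_fun setT (fun x => (r * \1_(h n @^-1` [set r]) x)%:E).
  by apply/measurable_EFinP; exact: measurable_funM.
under eq_integral do rewrite hE.
rewrite ge0_integral_fsum//; last by move=> y x _; exact: nnfun_muleindic_ge0.
transitivity (\int[mu]_x (\sum_(y \in range (h n))
    (y * \1_(h n @^-1` [set y]) x)%:E * (phi x)%:E))%E; last first.
  apply: eq_integral => x _; rewrite hE -ge0_mule_fsuml// => y.
  exact: nnfun_muleindic_ge0.
rewrite ge0_integral_fsum//; last 2 first.
- by move=> y; apply: emeasurable_funM.
- by move=> y x _; apply: mule_ge0; rewrite ?lee_fin//; exact: nnfun_muleindic_ge0.
apply: eq_fsbigr => r rhn.
have r0 : 0 <= r by move: rhn; rewrite inE => -[x _ <-].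
have mr : measurable (h n @^-1` [set r]) by exact: measurable_sfunP.
under eq_integral do rewrite EFinM.
rewrite integralZl_indic_nnsfun//= integral_indic// setIT nuE//.
under [RHS]eq_integral do rewrite EFinM -muleA.
rewrite ge0_integralZl//; last 2 first.
- by apply: emeasurable_funM => //; exact/measurable_EFinP.
- by move=> x _; rewrite mule_ge0// lee_fin.
rewrite integral_mkcond; congr (_ * _)%E; apply: eq_integral => x _.
by rewrite patchE indicE; case: (x \in _); rewrite ?mul1e ?mul0e.
Qed.

(** * From independence to orthogonality *)

Section independence.
Context (R : realType) d d' (Omega : measurableType d) (T : measurableType d').
Variable P : probability Omega R.

Lemma mutually_independent_pair (I : choiceType) (X : I -> Omega -> T) (i j : I)
    (A B : set T) : mutually_independent P X -> i != j ->
  measurable A -> measurable B ->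
  (P (X i @^-1` A `&` X j @^-1` B) = P (X i @^-1` A) * P (X j @^-1` B))%E.
Proof.
move=> indX ij mA mB.
(* The product rule is applied to the subfamily [[:: i; j]]; the value of [C] at other indices only
   has to be measurable. *)
pose C k := if k == i then A else B.
have := indX [:: i; j] C; rewrite big_cons big_seq1 /C eqxx eq_sym (negbTE ij).
rewrite /= inE ij/= => <- //; last by move=> k; case: ifP.
congr (P _); apply/seteqP; split => w /=.
  move=> [Aw Bw] k /=; rewrite !inE => /orP[/eqP ->|/eqP ->]; first by rewrite eqxx.
  by rewrite eq_sym (negbTE ij).
move=> H; split.
  by have := H i; rewrite /= eqxx; apply; rewrite inE eqxx.
by have := H j; rewrite /= eq_sym (negbTE ij); apply; rewrite !inE eqxx orbT.
Qed.

(** By independence the law of the pair agrees with the product of the marginals on rectangles,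
    hence everywhere. Fubini then isolates the integral of [h] under the law of [X j], which is
    0. *)
Lemma mutually_independent_orthogonal (I : choiceType) (X : I -> Omega -> T)
    (h : T -> R) (B : R) (i j : I) :
  mutually_independent P X -> (forall k, measurable_fun setT (X k)) ->
  measurable_fun setT h -> (forall x, `|h x| <= B) -> i != j ->
  (\int[P]_w (h (X j w))%:E = 0)%E ->
  (\int[P]_w (h (X i w) * h (X j w))%:E = 0)%E.
Proof.
move=> indX mX mh hB ij hj0.
have mXij : measurable_fun setT (fun w => (X i w, X j w)).
  exact: measurable_fun_pair.
pose Xi : {mfun Omega >-> T} := mfun_Sub (mem_set (mX i)).
pose Xj : {mfun Omega >-> T} := mfun_Sub (mem_set (mX j)).
pose Xij : {mfun Omega >-> (T * T)%type} := mfun_Sub (mem_set mXij).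
pose H (z : T * T) := (h z.1 * h z.2)%:E.
have mH : measurable_fun setT H.
  by apply/measurable_EFinP/measurable_funM; exact: measurableT_comp.
have HB (z : T * T) : `|h z.1 * h z.2| <= B ^+ 2.
  by rewrite normrM expr2 ler_pM.
transitivity (\int[distribution P Xij]_z H z)%E.
  rewrite integral_distribution//.
  apply: (bounded_measurable_integrable _ (f := fun w => h (X i w) * h (X j w))) => //.
    by apply: measurable_funM; exact: measurableT_comp.
  by move=> w; exact: (HB (X i w, X j w)).
transitivity (\int[(distribution P Xi \x distribution P Xj)%E]_z H z)%E.
  apply: eq_measure_integral => /= A mA _; apply/esym.
  apply: product_measure_unique => // C D mC mD.
  exact: (mutually_independent_pair indX ij mC mD).
rewrite -integral12_prod_meas1; last first.
  apply: (bounded_measurable_integrable _ (f := fun z => h z.1 * h z.2)) => //.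
    by apply: measurable_funM; exact: measurableT_comp.
rewrite /fubini_F /H/=.
under eq_integral => x _.
  under eq_integral do rewrite EFinM.
  rewrite integralZl//; last exact: (bounded_measurable_integrable _ (f := h)).
  rewrite (_ : \int[_]_y _ = 0)%E ?mule0; last first.
    rewrite integral_distribution//; first exact/measurable_EFinP.
    apply: (bounded_measurable_integrable _ (f := h \o X j) (B := B)) => [|w].
      exact: measurableT_comp.
    exact: hB.
  over.
by rewrite integral0.
Qed.
End independence.

(** * Deterministic analysis of the selection rules *)

Variant min_threshold_spec (lo hi t0 : nat) (p : pred nat) : nat -> Prop :=
  | MinThresholdIn m of (lo <= m < hi)%N & p m &
      (forall t, (lo <= t < hi)%N -> p t -> (m <= t)%N) :
      min_threshold_spec lo hi t0 p m
  | MinThresholdOut of (forall t, (lo <= t < hi)%N -> ~~ p t) :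
      min_threshold_spec lo hi t0 p t0.

Lemma min_thresholdP (lo hi t0 : nat) (p : pred nat) :
  min_threshold_spec lo hi t0 p (min_threshold lo hi t0 p).
Proof.
rewrite /min_threshold.
have srt : sorted leq [seq t <- index_iota lo hi | p t].
  by apply: sorted_filter; [exact: leq_trans|exact: iota_sorted].
have memE t : (t \in [seq t <- index_iota lo hi | p t]) = p t && (lo <= t < hi)%N.
  by rewrite mem_filter mem_index_iota.
case: [seq t <- _ | _] srt memE => [_|m l ml] memE.
  by apply: MinThresholdOut => t tlh; have := memE t; rewrite tlh andbT => <-.
have := memE m; rewrite inE eqxx => /esym/andP[pm mlh].
apply: MinThresholdIn => // t tlh pt.
have := memE t; rewrite tlh pt inE => /orP[/eqP -> //|tl].
by have /allP/(_ _ tl) := order_path_min leq_trans ml.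
Qed.

Section thresholds.
Context (R : realType) (tmax : nat) (Ustar : R) (U : nat -> R).
Hypothesis tmax_gt0 : (0 < tmax)%N.
Hypothesis Utmax : Ustar <= U tmax.
Hypothesis U_increasing : forall t t', (t < t')%N -> (t' <= tmax)%N -> U t < U t'.
Let ts := t_star tmax Ustar U.

(** The hypotheses are weak enough for both rules: [p t] is required only if [U] exceeds the target
    on all of [t], ..., [tmax], as the monotone rule demands. Nothing is asked where [U t = Ustar],
    which may happen at [ts]; hence the slack of one. *)
Lemma min_threshold_near_t_star (p : pred nat) :
  (forall t, (0 < t < tmax)%N -> U t < Ustar -> ~~ p t) ->
  (forall t, (0 < t < tmax)%N ->
     (forall t', (t <= t')%N -> (t' <= tmax)%N -> Ustar < U t') -> p t) ->
  (ts <= min_threshold 1 tmax tmax p <= ts.+1)%N.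
Proof.
move=> plt pgt; rewrite /ts /t_star.
case: min_thresholdP => [s /andP[s1 st] Us smin|H]; last first.
  by have := H tmax; rewrite tmax_gt0 ltnS leqnn Utmax => /(_ isT).
have Ult t : (0 < t)%N -> (t < s)%N -> U t < Ustar.
  move=> t0 lt_ts; rewrite ltNge; apply/negP => UU.
  by have := smin t; rewrite t0 (ltn_trans lt_ts st) leqNgt lt_ts => /(_ isT UU).
have Ugt t : (s < t)%N -> (t <= tmax)%N -> Ustar < U t.
  by move=> st1 tm; rewrite (le_lt_trans Us)// U_increasing.
case: min_thresholdP => [m mt pm mmin|H].
  apply/andP; split.
    rewrite leqNgt; apply/negP => ms; have /andP[m0 _] := mt.
    by by have := plt m mt (Ult _ m0 ms); rewrite pm.
  (* If [s.+1 < tmax] then [s.+1] is a candidate that passes; otherwise [m < tmax <= s.+1]. *)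
  have [stm|] := ltnP s.+1 tmax; last by have /andP[_ ?] := mt; lia.
  apply: mmin; first by rewrite stm.
  by apply: pgt; [rewrite stm|move=> t' st' t't; exact: Ugt].
(* The default [tmax] is returned here; it cannot exceed [s.+1], since [s.+1] would then be a
   passing candidate. *)
rewrite -ltnS st/=; have [stm|//] := ltnP s.+1 tmax.
by have := H s.+1 stm; rewrite pgt.
Qed.

Lemma t_union_near_t_star (L : nat -> R -> R) (alpha : R) :
  (forall t, (0 < t < tmax)%N -> U t < Ustar -> L t (alpha / (tmax%:R - 1)) < Ustar) ->
  (forall t, (0 < t < tmax)%N -> Ustar < U t -> Ustar <= L t (alpha / (tmax%:R - 1))) ->
  (ts <= t_union tmax Ustar L alpha <= ts.+1)%N.
Proof.
move=> Llt Lgt; apply: min_threshold_near_t_star => t tt.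
  by move=> Ut; rewrite -ltNge Llt.
by move=> H; apply: Lgt => //; apply: H => //; case/andP: tt => _ /ltnW.
Qed.

Lemma t_mono_near_t_star (L : nat -> R -> R) (alpha : R) :
  (forall t, (0 < t < tmax)%N -> U t < Ustar -> L t alpha < Ustar) ->
  (forall t, (0 < t < tmax)%N -> Ustar < U t -> Ustar <= L t alpha) ->
  (ts <= t_mono tmax Ustar L alpha <= ts.+1)%N.
Proof.
move=> Llt Lgt; apply: min_threshold_near_t_star => t tt.
  (* The simultaneous test already fails at its first threshold [t' = t]. *)
  move=> Ut; apply/negP => /allP/(_ t); rewrite mem_index_iota leqnn.
  by case/andP: (tt) => _ -> /(_ isT); rewrite leNgt Llt.
move=> H; apply/allP => t'; rewrite mem_index_iota => /andP[tt' t't].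
apply: Lgt; last by apply: H => //; exact: ltnW.
by rewrite t't andbT (leq_trans _ tt')//; case/andP: tt.
Qed.
End thresholds.

(** * Vanishing of the penalties in the lower bound *)

Section lower_bound_limit.
Variable R : realType.

Lemma sample_variance_ge0 (m : nat) (z : R ^nat) : (0 < m)%N -> 0 <= sample_variance m z.
Proof.
move=> m0; rewrite mulr_ge0//.
  by rewrite divr_ge0// mulr_ge0// subr_ge0 ler1n.
by apply: sumr_ge0 => j _; apply: sumr_ge0 => i _; exact: sqr_ge0.
Qed.

(** Each squared difference is at most [(2 * B) ^+ 2], and each [j] is paired with at most [m - 1]
    smaller indices, a count that the normalisation cancels. *)
Lemma sample_variance_le (m : nat) (z : R ^nat) (B : R) : (1 < m)%N ->
  (forall i, `|z i| <= B) -> sample_variance m z <= 4 * B ^+ 2.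
Proof.
move=> m1 zB; have B0 : 0 <= B by exact: le_trans (zB 0%N).
have mm0 : 0 < m%:R * (m%:R - 1) :> R.
  by rewrite mulr_gt0 ?subr_gt0 ?ltr1n// ltr0n ltnW.
rewrite /sample_variance div1r mulrC ler_pdivrMr//.
have zz i j : (z i - z j) ^+ 2 <= 4 * B ^+ 2.
  have := zB i; have := zB j; rewrite !ler_norml => /andP[? ?] /andP[? ?].
  by nra.
apply: (@le_trans _ _ (\sum_(j < m) (4 * B ^+ 2 * (m%:R - 1)))); last first.
  by rewrite sumr_const card_ord -mulr_natr le_eqVlt; apply/orP; left; apply/eqP; ring.
apply: ler_sum => j _.
apply: le_trans; first by apply: ler_sum => i _; exact: zz.
rewrite (sumr_const [pred i : 'I_m | (i < j)%N]) -[leLHS]mulr_natr ler_wpM2l//.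
  by rewrite mulr_ge0// sqr_ge0.
have -> : m%:R - 1 = m.-1%:R :> R by rewrite -subn1 natrB// ltnW.
rewrite ler_nat -[in leqRHS](card_ord m) -(cardC1 j); apply: subset_leq_card.
by apply/fintype.subsetP => i; rewrite !inE; apply: contraTneq => ->; rewrite ltnn.
Qed.

Lemma cvg_sqrt_invn : Num.sqrt m%:R^-1 @[m --> \oo] --> (0 : R).
Proof.
rewrite -[X in _ --> X]sqrtr0.
apply: (@cvg_comp _ _ _ (fun m : nat => m%:R^-1 : R)); last exact: sqrt_continuous.
rewrite -cvg_shiftS/=; exact: cvg_harmonic.
Qed.

(** The variance penalty is of order [1 / sqrt m] because the sample variance is bounded: 8 is
    [2 * 4]. In the linear penalty the clipping level [sqrt m] is divided by [m - 1], which gives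
    the same order. *)
Lemma lower_bound_sub_mean (z : R ^nat) (B a : R) (t m : nat) : (1 < m)%N ->
  0 < a <= 1 -> (forall i, `|z i| <= B) ->
  `|lower_bound m (Num.sqrt m%:R) z t a - sample_mean m z| <=
  (Num.sqrt (8 * B ^+ 2 * ln (2 / a)) + 14 * t%:R * ln (2 / a)) * Num.sqrt m%:R^-1.
Proof.
move=> m1 /andP[a0 a1] zB.
have B0 : 0 <= B by exact: le_trans (zB 0%N).
rewrite /lower_bound; set l := ln (2 / a).
have l0 : 0 <= l by rewrite ln_ge0// ler_pdivlMr// mul1r; lra.
set mu := sample_mean m z; set V := sample_variance m z.
have m0 : 0 < m%:R :> R by rewrite ltr0n ltnW.
have m2 : 2 <= m%:R :> R by rewrite ler_nat.
have V0 : 0 <= V by apply: sample_variance_ge0; exact: ltnW.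
have VB : V <= 4 * B ^+ 2 by exact: sample_variance_le.
set q := Num.sqrt m%:R; have q0 : 0 < q by rewrite sqrtr_gt0.
have qq : q ^+ 2 = m%:R by rewrite sqr_sqrtr// ltW.
have -> : Num.sqrt m%:R^-1 = q^-1 :> R by rewrite sqrtrV// ltW.
rewrite [leRHS]mulrDl.
have -> : mu - Num.sqrt (2 * V * l / m%:R) - 7 * t%:R * q * l / (3 * (m%:R - 1)) - mu
  = - (Num.sqrt (2 * V * l / m%:R) + 7 * t%:R * q * l / (3 * (m%:R - 1))) by ring.
rewrite normrN ger0_norm; last first.
  rewrite addr_ge0// divr_ge0// ?mulr_ge0// ?(ltW q0)// subr_ge0; lra.
apply: lerD.
  rewrite [in leLHS]sqrtrM; last by rewrite mulr_ge0// mulr_ge0.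
  rewrite sqrtrV ?(ltW m0)// -/q.
  rewrite ler_wpM2r ?invr_ge0 ?(ltW q0)// ler_sqrt ?mulr_ge0 ?sqr_ge0//.
  by rewrite ler_wpM2r//; lra.
have -> : 14 * t%:R * l * q^-1 = 7 * t%:R * l * (2 / q) by ring.
have -> : 7 * t%:R * q * l / (3 * (m%:R - 1)) = 7 * t%:R * l * (q / (3 * (m%:R - 1))).
  by ring.
(* The inequality [q / (3 * (m - 1)) <= 2 / q] amounts to [m <= 6 * (m - 1)], which holds from
   [m = 2] on; this is the origin of [14 = 7 * 2]. *)
rewrite ler_wpM2l ?mulr_ge0// ler_pdivrMr; last by rewrite mulr_gt0//; lra.
rewrite mulrAC ler_pdivlMr// -expr2 qq; lra.
Qed.

Lemma cvg_lower_bound (z : R ^nat) (B mu a : R) (t : nat) :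
  0 < a <= 1 -> (forall i, `|z i| <= B) ->
  sample_mean m z @[m --> \oo] --> mu ->
  lower_bound m (Num.sqrt m%:R) z t a @[m --> \oo] --> mu.
Proof.
move=> a01 zB cvgz.
pose D m := lower_bound m (Num.sqrt m%:R) z t a - sample_mean m z.
pose C := Num.sqrt (8 * B ^+ 2 * ln (2 / a)) + 14 * t%:R * ln (2 / a).
have cvgD0 : D m @[m --> \oo] --> (0 : R).
  apply: norm_cvg0.
  apply: (@squeeze_cvgr _ _ _ _ (fun=> 0)
    (fun m => C * Num.sqrt m%:R^-1)).
  - near=> m; rewrite normr_ge0/=; apply: lower_bound_sub_mean => //.
    by near: m; exact: nbhs_infty_gt.
  - exact: cvg_cst.
  - by rewrite -[X in _ --> X](mulr0 C); apply: cvgMr; exact: cvg_sqrt_invn.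
have -> : (fun m => lower_bound m (Num.sqrt m%:R) z t a) = (fun m => D m + sample_mean m z).
  by apply/funext => m; rewrite subrK.
by rewrite -[mu]add0r; apply: cvgD.
Unshelve. all: by end_near. Qed.

End lower_bound_limit.

(** * Joint law of a request and its observation vector *)

Section joint_law.
Context (R : realType) d d1 d2 (Omega : measurableType d) (T1 : measurableType d1)
  (T2 : measurableType d2) (P : probability Omega R) (mu : probability T1 R)
  (K : R.-pker T1 ~> T2) (X : Omega -> T1) (O : Omega -> T2).
Hypothesis mX : measurable_fun setT X.
Hypothesis mO : measurable_fun setT O.
Hypothesis law : forall (A : set T1) (B : set T2), measurable A -> measurable B ->
  (P (X @^-1` A `&` O @^-1` B) = \int[mu]_(x in A) K x B)%E.

Lemma pker_fin_num (x : T1) (B : set T2) : measurable B -> K x B \is a fin_num.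
Proof.
move=> mB; rewrite ge0_fin_numE//; apply: (@le_lt_trans _ _ (K x setT)).
  by apply: le_measure => //; rewrite inE.
by rewrite prob_kernel ltry.
Qed.

Lemma measurable_pker_fine (B : set T2) : measurable B ->
  measurable_fun setT (fun x => fine (K x B)).
Proof. by move=> mB; apply: measurableT_comp => //; exact: measurable_kernel. Qed.

(** The observation is integrated out first. Both sides are the integral of [g] against [nu], the
    image under [X] of [P] restricted to the event that [O] lies in [B]; by [law], [nu] has density
    [K x B] with respect to [mu]. *)
Lemma integral_joint_law (g : T1 -> R) (B : set T2) : measurable B ->
  measurable_fun setT g -> (forall x, 0 <= g x) ->
  (\int[P]_w (g (X w) * \1_B (O w))%:E = \int[mu]_x (g x * fine (K x B))%:E)%E.
Proof.
move=> mB mg g0.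
have mOB : measurable (O @^-1` B) by rewrite -[X in measurable X]setTI; exact: mO.
pose X' : {mfun Omega >-> T1} := mfun_Sub (mem_set mX).
pose nu := pushforward (mrestr P mOB) X'.
have mgE : measurable_fun setT (EFin \o g) by exact/measurable_EFinP.
transitivity (\int[nu]_x (g x)%:E)%E; last first.
  rewrite (@ge0_integral_density _ _ _ mu _ (fun x => fine (K x B))) => [//|||A mA||].
  - exact: measurable_pker_fine.
  - by move=> x; exact: fine_ge0.
  - rewrite /nu /pushforward /mrestr/=; transitivity (\int[mu]_(x in A) K x B)%E; first exact: law.
    by apply: eq_integral => x _; rewrite fineK// pker_fin_num.
  - exact: mgE.
  - by move=> x; rewrite lee_fin.
rewrite ge0_integral_pushforward//; last by move=> x _; rewrite lee_fin.
rewrite preimage_setT.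
(* Restricting [P] to an event amounts to giving it the indicator of that event as density. *)
rewrite (@ge0_integral_density _ _ _ P _ \1_(O @^-1` B)) => [//|||A mA||].
- exact: measurable_indic.
- by move=> x; rewrite indicE.
- by rewrite /mrestr integral_indic// setIC.
- exact: measurableT_comp.
- by move=> x; rewrite lee_fin.
Qed.
End joint_law.

(** * Inverse-propensity weighted terms: measurability, bounds and mean *)

Section ipw.
Context (R : realType) (n : nat) (dQ : measure_display) (Q : measurableType dQ).
Variable K : R.-pker (Q * n.-tuple bool)%type ~> n.-tuple bool.
Variables (s : Q -> nat -> 'I_n) (tmax : nat) (gamma : R).
Hypothesis s_measurable : forall j i, (0 < j <= tmax)%N ->
  measurable [set q : Q | s q j = i].
Hypothesis gamma_gt0 : 0 < gamma.
Hypothesis propensity_gt : forall q (r : n.-tuple bool) j, (0 < j <= tmax)%N ->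
  gamma < propensity K (q, r) (s q j).

(* The weight of the observation of item [i] at position [j]: a function of the
   request alone, so that the expectation of [ipw_term] is computed by
   integrating the observation first. *)
Definition ipw_coef (j : nat) (i : 'I_n) (x : Q * n.-tuple bool) : R :=
  \1_[set q | s q j = i] x.1 * (propensity K x i)^-1 *
  \1_[set r : n.-tuple bool | tnth r i] x.2.

Definition ipw_term (t : nat) (z : (Q * n.-tuple bool) * n.-tuple bool) : R :=
  \sum_(1 <= j < t.+1)
    1 / propensity K z.1 (s z.1.1 j) * feedback R z.2 z.1.2 (s z.1.1 j).

Lemma indic_tnth (i : 'I_n) (r : n.-tuple bool) :
  \1_[set r : n.-tuple bool | tnth r i] r = (tnth r i : nat)%:R :> R.
Proof. by rewrite indicE; congr (nat_of_bool _)%:R; apply/idP/idP; rewrite inE. Qed.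

Lemma sum_indic_eq (q : Q) (j : nat) (F : 'I_n -> R) :
  \sum_(i < n) \1_[set q | s q j = i] q * F i = F (s q j).
Proof.
rewrite (bigD1 (s q j))//= big1 ?addr0.
  by rewrite indicE mem_set// mul1r.
by move=> i ij; rewrite indicE memNset ?mul0r//= => /esym/eqP; exact/negP.
Qed.

(** The item at position [j] depends on the query; summing over all items with the indicator of
    [s q j = i] leaves products of a function of the request and an event on the observation of a
    fixed item. *)
Lemma ipw_termE (t : nat) z :
  ipw_term t z = \sum_(j < t) \sum_(i < n)
    ipw_coef j.+1 i z.1 * \1_[set o : n.-tuple bool | tnth o i] z.2.
Proof.
rewrite /ipw_term big_add1 big_mkord.
apply: eq_bigr => j _; under eq_bigr do rewrite /ipw_coef -!mulrA.
rewrite sum_indic_eq !indic_tnth /feedback div1r; congr (_ * _).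
by rewrite mulrC.
Qed.

Lemma measurable_tnth_true (i : 'I_n) : measurable [set r : n.-tuple bool | tnth r i].
Proof.
rewrite (_ : [set _ | _] = (fun r : n.-tuple bool => tnth r i) @^-1` [set true]).
  by rewrite -[X in measurable X]setTI; exact: measurable_tnth.
by apply/seteqP; split => r /=; case: (tnth r i).
Qed.

Lemma measurable_propensity (i : 'I_n) : measurable_fun setT (propensity K ^~ i).
Proof. by apply: measurable_pker_fine; exact: measurable_tnth_true. Qed.

Lemma propensity_ge0 x (i : 'I_n) : 0 <= propensity K x i.
Proof. exact: fine_ge0. Qed.

Lemma ipw_coef_ge0 j i x : 0 <= ipw_coef j i x.
Proof. by rewrite !mulr_ge0// ?invr_ge0 ?propensity_ge0// indicE. Qed.

Lemma measurable_ipw_coef j i : (0 < j <= tmax)%N -> measurable_fun setT (ipw_coef j i).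
Proof.
move=> jt; apply: measurable_funM; first apply: measurable_funM.
- by apply: measurableT_comp => //; apply: measurable_indic; exact: s_measurable.
(* The inverse is read as the power -1, whose measurability is known; the two agree on nonnegative
   reals. *)
- rewrite (_ : (fun x => _) = (fun p => p `^ (-1)) \o (propensity K ^~ i)).
    by apply: measurableT_comp; [exact: measurable_powR|exact: measurable_propensity].
  by apply/funext => x /=; rewrite powR_inv1// propensity_ge0.
- by apply: measurableT_comp => //; apply: measurable_indic; exact: measurable_tnth_true.
Qed.

Lemma measurable_ipw_term t : (t <= tmax)%N -> measurable_fun setT (ipw_term t).
Proof.
move=> tt; rewrite (funext (ipw_termE t)).
apply: measurable_sum => j; apply: measurable_sum => i; apply: measurable_funM.
  by apply: measurableT_comp => //; apply: measurable_ipw_coef; rewrite /= (leq_trans _ tt).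
apply: measurableT_comp => //; apply: measurable_indic; exact: measurable_tnth_true.
Qed.

Lemma ipw_term_ge0 t z : 0 <= ipw_term t z.
Proof.
apply: sumr_ge0 => j _; rewrite mulr_ge0 ?divr_ge0 ?propensity_ge0//.
by rewrite /feedback mulr_ge0.
Qed.

Lemma ipw_term_le t z : (t <= tmax)%N -> ipw_term t z <= t%:R / gamma.
Proof.
move=> tt; rewrite /ipw_term.
apply: (@le_trans _ _ (\sum_(1 <= j < t.+1) gamma^-1)); last first.
  by rewrite sumr_const_nat subn1 mulr_natl.
rewrite big_nat [leRHS]big_nat; apply: ler_sum => j /andP[j0 jt].
have pg : gamma < propensity K z.1 (s z.1.1 j).
  by case: z => -[q r] o; apply: propensity_gt; rewrite j0 (leq_trans _ tt).
rewrite div1r -[leRHS]mulr1 ler_pM// ?invr_ge0 ?propensity_ge0//.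
- by rewrite /feedback mulr_ge0.
- by rewrite lef_pV2 ?posrE// ?ltW// (lt_trans gamma_gt0).
- by rewrite /feedback; case: (tnth _ _); case: (tnth _ _); rewrite ?mulr1 ?mul1r ?mul0r.
Qed.

(** Every weight is below [1 / gamma], so a clipping level of at least [gamma^-1] never takes
    effect. *)
Lemma clipped_termE lambda t x o : (t <= tmax)%N -> gamma^-1 <= lambda ->
  clipped_term K s lambda t x o = ipw_term t (x, o).
Proof.
move=> tt gl; rewrite /clipped_term /ipw_term big_nat [RHS]big_nat.
apply: eq_bigr => j /andP[j0 jt]; congr (_ * _); apply/min_idPr.
have pg : gamma < propensity K x (s x.1 j).
  by case: x => q r; apply: propensity_gt; rewrite j0 (leq_trans _ tt).
rewrite (le_trans _ gl)// div1r lef_pV2 ?posrE// ?ltW//.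
by rewrite (lt_trans gamma_gt0).
Qed.

Context (PQR : probability (Q * n.-tuple bool)%type R).
Context d (Omega : measurableType d) (P : probability Omega R).
Variables (X : Omega -> Q * n.-tuple bool) (O : Omega -> n.-tuple bool).
Hypothesis mX : measurable_fun setT X.
Hypothesis mO : measurable_fun setT O.
Hypothesis law : forall (A : set (Q * n.-tuple bool)) (B : set (n.-tuple bool)),
  measurable A -> measurable B ->
  (P (X @^-1` A `&` O @^-1` B) = \int[PQR]_(x in A) K x B)%E.

(** Unbiasedness: integrating the observation first turns its indicator into the propensity, which
    cancels the weight and leaves the relevance. *)
Lemma integral_ipw_term t : (t <= tmax)%N ->
  (\int[P]_w (ipw_term t (X w, O w))%:E = (utility PQR s t)%:E)%E.
Proof.
move=> tt.
have jtm (j : 'I_t) : (0 < j.+1 <= tmax)%N by rewrite /= (leq_trans _ tt).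
have mtrue := measurable_tnth_true.
have mcoef (j : 'I_t) i : measurable_fun setT (ipw_coef j.+1 i) by exact: measurable_ipw_coef.
pose rel (j : nat) (i : 'I_n) (x : Q * n.-tuple bool) : R :=
  \1_[set q | s q j = i] x.1 * \1_[set r : n.-tuple bool | tnth r i] x.2.
have rel_ge0 j i x : 0 <= rel j i x by rewrite mulr_ge0// indicE.
have coefE (j : 'I_t) i x : ipw_coef j.+1 i x * propensity K x i = rel j.+1 i x.
  rewrite /ipw_coef /rel; have [sx|/eqP sx] := eqVneq (s x.1 j.+1) i; last first.
    by rewrite indicE memNset// !mul0r.
  (* The propensity is known to be nonzero only for the item at position [j.+1]; for any other item
     both sides have just been seen to vanish. *)
  rewrite mulrAC -[X in X * _ = _]mulrA mulVf ?mulr1// gt_eqF// (lt_trans gamma_gt0)// -sx.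
  by case: x {sx} => q r; exact: propensity_gt.
have mrel (j : 'I_t) i : measurable_fun setT (rel j.+1 i).
  apply: measurable_funM; apply: measurableT_comp => //; apply: measurable_indic => //.
  exact: s_measurable.
pose r (x : Q * n.-tuple bool) : R := \sum_(1 <= j < t.+1) (tnth x.2 (s x.1 j) : nat)%:R.
have rE x : r x = \sum_(j < t) \sum_(i < n) rel j.+1 i x.
  rewrite /r big_add1 big_mkord; apply: eq_bigr => j _.
  by rewrite /rel sum_indic_eq indic_tnth.
have r_le x : `|r x| <= t%:R.
  rewrite ger0_norm ?sumr_ge0// /r big_add1 big_mkord.
  apply: (@le_trans _ _ (\sum_(j < t) 1)); last by rewrite sumr_const card_ord.
  by apply: ler_sum => j _; case: (tnth _ _).
have mr : measurable_fun setT r.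
  by rewrite (funext rE); apply: measurable_sum => j; apply: measurable_sum => i.
transitivity (\int[PQR]_x \sum_(j < t) \sum_(i < n) (rel j.+1 i x)%:E)%E; last first.
  rewrite /utility expectation.unlock fineK; last first.
    exact: (integrable_fin_num measurableT (bounded_measurable_integrable _ mr r_le)).
  apply: eq_integral => x _; rewrite -/(r x) rE -sumEFin.
  by apply: eq_bigr => j _; rewrite sumEFin.
under eq_integral.
  move=> w _; rewrite ipw_termE -sumEFin.
  under eq_bigr do rewrite -sumEFin.
  over.
have mPsum (j : 'I_t) i : measurable_fun setT (fun w => (ipw_coef j.+1 i (X w) *
    \1_[set o : n.-tuple bool | tnth o i] (O w))%:E).
  apply/measurable_EFinP; apply: measurable_funM; first exact: measurableT_comp.
  by apply: measurableT_comp => //; exact: measurable_indic.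
rewrite ge0_integral_sum//=; last 2 first.
- by move=> j; apply: emeasurable_sum => i; exact: mPsum.
- by move=> j w _; apply: sume_ge0 => i _; rewrite lee_fin mulr_ge0 ?ipw_coef_ge0// indicE.
rewrite [RHS]ge0_integral_sum//=; last 2 first.
- by move=> j; apply: emeasurable_sum => i; exact/measurable_EFinP.
- by move=> j w _; apply: sume_ge0 => i _; rewrite lee_fin.
apply: eq_bigr => j _.
rewrite ge0_integral_sum//=; last first.
- by move=> i w _; rewrite lee_fin mulr_ge0 ?ipw_coef_ge0// indicE.
rewrite [RHS]ge0_integral_sum//=; last 2 first.
- by move=> i; exact/measurable_EFinP.
- by move=> i x _; rewrite lee_fin.
apply: eq_bigr => i _.
rewrite (integral_joint_law mX mO law)//; last by move=> x; exact: ipw_coef_ge0.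
by apply: eq_integral => x _; rewrite -coefE.
Qed.


End ipw.

(** * Almost sure consistency of the lower bound *)

Section consistency.
Context (R : realType) (n : nat) (dQ d : measure_display) (Q : measurableType dQ)
  (Omega : measurableType d).
Context (PQR : probability (Q * n.-tuple bool)%type R)
  (K : R.-pker (Q * n.-tuple bool)%type ~> n.-tuple bool) (P : probability Omega R).
Variables (X : nat -> Omega -> Q * n.-tuple bool) (O : nat -> Omega -> n.-tuple bool).
Hypothesis log : logged_data PQR K P X O.
Variables (s : Q -> nat -> 'I_n) (tmax : nat) (gamma : R).
Hypothesis s_measurable : forall j i, (0 < j <= tmax)%N ->
  measurable [set q : Q | s q j = i].
Hypothesis gamma_gt0 : 0 < gamma.
Hypothesis propensity_gt : forall q (r : n.-tuple bool) j, (0 < j <= tmax)%N ->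
  gamma < propensity K (q, r) (s q j).

(** Subtracting the utility, which is the mean of every term, gives bounded centred variables;
    independence makes them orthogonal, so the strong law applies. *)
Lemma ae_cvg_mean_ipw t : (t <= tmax)%N ->
  {ae P, forall w, sample_mean m (fun i => ipw_term K s t (X i w, O i w))
    @[m --> \oo] --> utility PQR s t}.
Proof.
move=> tt; have [mX mO law ind] := log.
pose U := utility PQR s t; pose h z := ipw_term K s t z - U.
have mW i : measurable_fun setT (fun w => (X i w, O i w)) by exact: measurable_fun_pair.
have mipw : measurable_fun setT (ipw_term K s t) by exact: measurable_ipw_term s_measurable _ tt.
have mh : measurable_fun setT h by apply: measurable_funB.
have ipw_le z : `|ipw_term K s t z| <= t%:R / gamma.
  by rewrite ger0_norm ?ipw_term_ge0//; exact: ipw_term_le propensity_gt _ _ tt.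
have h_le z : `|h z| <= t%:R / gamma + `|U|.
  by rewrite (le_trans (ler_normB _ _))// lerD2r.
have h_centered i : (\int[P]_w (h (X i w, O i w))%:E = 0)%E.
  under eq_integral do rewrite EFinB.
  rewrite integralB//=; last 2 first.
  - apply: (bounded_measurable_integrable _ (f := fun w => ipw_term K s t (X i w, O i w))
      (B := t%:R / gamma)) => //; exact: measurableT_comp.
  - exact: finite_measure_integrable_cst.
  rewrite (integral_ipw_term s_measurable gamma_gt0 propensity_gt (mX i) (mO i) (law i) tt).
  by rewrite integral_cst//= probability_setT mule1 subee.
have : {ae P, forall w,
    (\sum_(i < m) h (X i w, O i w) / m%:R) @[m --> \oo] --> (0 : R)}.
  apply: (@bounded_orthogonal_slln _ _ _ P (fun i w => h (X i w, O i w))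
    (t%:R / gamma + `|U|)) => [i|i w|i j ij].
  - exact: measurableT_comp.
  - exact: h_le.
  - exact: (mutually_independent_orthogonal ind mW mh h_le ij).
apply: filterS => w cvg0.
(* The shift to [m.+1] avoids the empty sample, for which the mean of the constant [U] is 0 rather
   than [U]. *)
rewrite -[X in _ --> X]add0r -cvg_shiftS/=.
have -> : (fun m => sample_mean m.+1 (fun i => ipw_term K s t (X i w, O i w))) =
    (fun m => \sum_(i < m.+1) h (X i w, O i w) / m.+1%:R + U).
  apply/funext => m; rewrite -mulr_suml big_split/= sumr_const card_ord /sample_mean.
  rewrite mulrDl mulNrn mulNr -[U *+ _]mulr_natr mulfK ?pnatr_eq0// subrK.
  by rewrite div1r mulrC.
apply: cvgD; last exact: cvg_cst.
by rewrite (cvg_shiftS (fun m => \sum_(i < m) h (X i w, O i w) / m%:R)).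
Qed.

(** For [m] above the square of [gamma^-1] clipping is inactive, whatever the realization, so the
    bound eventually equals the one built from the unclipped terms. *)
Lemma ae_cvg_CIPW_lower_bound t (a : R) : (t <= tmax)%N -> 0 < a <= 1 ->
  {ae P, forall w, CIPW_lower_bound K s (Num.sqrt m%:R) m (X ^~ w) (O ^~ w) t a
    @[m --> \oo] --> utility PQR s t}.
Proof.
move=> tt a01; have := ae_cvg_mean_ipw tt; apply: filterS => w cvgm.
pose z i := ipw_term K s t (X i w, O i w).
have zB i : `|z i| <= t%:R / gamma.
  by rewrite ger0_norm ?ipw_term_ge0//; exact: ipw_term_le propensity_gt _ _ tt.
apply: cvg_trans (@cvg_lower_bound _ z _ _ a t a01 zB cvgm).
apply: near_eq_cvg; near=> m.
rewrite /CIPW_lower_bound; congr lower_bound; apply/funext => i.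
rewrite (clipped_termE gamma_gt0 propensity_gt)//.
rewrite -[leLHS]ger0_norm ?invr_ge0 ?(ltW gamma_gt0)// -sqrtr_sqr ler_sqrt ?ler0n// ltW//.
by near: m; exact: nbhs_infty_gtr.
Unshelve. all: by end_near. Qed.

Lemma ae_threshold_consistency (Ustar a : R) : 0 < a <= 1 ->
  {ae P, forall w, exists2 c : R, 0 < c & forall m : nat, c < m%:R ->
    forall t, (0 < t < tmax)%N ->
      let l := CIPW_lower_bound K s (Num.sqrt m%:R) m (X ^~ w) (O ^~ w) t a in
      (utility PQR s t < Ustar -> l < Ustar) /\ (Ustar < utility PQR s t -> Ustar <= l)}.
Proof.
move=> a01.
pose l w m t := CIPW_lower_bound K s (Num.sqrt m%:R) m (X ^~ w) (O ^~ w) t a.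
have : {ae P, forall w t, (t <= tmax)%N -> l w m t @[m --> \oo] --> utility PQR s t}.
  (* A countable union of null sets is null, so one event of full measure serves all [t]. Below,
     finiteness of ['I_tmax] yields a single rank [N]. *)
  apply: ae_foralln => t; have [tt|tt] := leqP t tmax.
    by apply: filterS (ae_cvg_CIPW_lower_bound tt a01).
  exact: aeW.
apply: filterS => w cvgl.
have [N _ HN] : \forall m \near \oo, forall t : 'I_tmax,
    (utility PQR s t < Ustar -> l w m t < Ustar) /\ (Ustar < utility PQR s t -> Ustar <= l w m t).
  apply: filter_forall => t; have cvgt := cvgl t (ltnW (ltn_ord t)).
  have [Ut|Ut] := ltP (utility PQR s t) Ustar.
    near=> m; have lm : l w m t < Ustar by near: m; exact: cvgr_lt cvgt _ Ut.
    split=> // Ut'.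
    by have := lt_trans Ut Ut'; rewrite ltxx.
  have [Ut'|Ut'] := ltP Ustar (utility PQR s t); last by apply: nearW.
  near=> m; have lm : Ustar < l w m t by near: m; exact: cvgr_gt cvgt _ Ut'.
  by split=> // _; exact: ltW.
exists N.+1%:R => [|m]; first exact: ltr0Sn.
rewrite ltr_nat => Nm t /andP[_ tt] /=.
by apply: (HN m _ (Ordinal tt)); rewrite /= ltnW// ltnW.
Unshelve. all: by end_near. Qed.
End consistency.

Theorem proposition4p8 (R : realType)
  (n : nat) (D : Type) (item : 'I_n -> D)
  (G : Type) (group : G -> {set 'I_n})
  (dQ : measure_display) (Q : measurableType dQ)
  (PQR : probability (Q * n.-tuple bool)%type R)
  (f : Q -> D -> R) (f01 : forall q x, 0 <= f q x <= 1)
  (sigma : G -> Q -> nat -> 'I_n)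
  (sigma_ranking : forall g q,
     is_ranking (fun i => f q (item i)) (group g) (sigma g q))
  (sigma_measurable : forall g j i, (1 <= j <= #|group g|)%N ->
     measurable [set q : Q | sigma g q j = i])
  (tmax : G -> nat) (tmax_bounds : forall g, (1 <= tmax g <= #|group g|)%N)
  (Ustar : G -> R)
  (K : R.-pker (Q * n.-tuple bool)%type ~> n.-tuple bool)
  (d : measure_display) (Omega : measurableType d) (P : probability Omega R)
  (X : nat -> Omega -> Q * n.-tuple bool) (O : nat -> Omega -> n.-tuple bool)
  (log : logged_data PQR K P X O)
  (hi : forall g, Ustar g <= utility PQR (sigma g) (tmax g) /\ 0 < Ustar g)
  (hii : exists2 gamma : R, 0 < gamma &
     forall g q (r : n.-tuple bool) j, (1 <= j <= tmax g)%N ->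
       gamma < propensity K (q, r) (sigma g q j))
  (hiii : forall g t t', (t < t')%N -> (t' <= tmax g)%N ->
     utility PQR (sigma g) t < utility PQR (sigma g) t')
  (g : G) (alpha : R) (halpha : 0 < alpha < 1) :
  let tstar := t_star (tmax g) (Ustar g) (utility PQR (sigma g)) in
  let L m w := CIPW_lower_bound K (sigma g) (Num.sqrt m%:R) m
                 (fun i => X i w) (fun i => O i w) in
  {ae P, forall w, exists2 c : R, 0 < c & forall m : nat, c < m%:R ->
     (tstar <= t_union (tmax g) (Ustar g) (L m w) alpha <= tstar.+1)%N} /\
  {ae P, forall w, exists2 c : R, 0 < c & forall m : nat, c < m%:R ->
     (tstar <= t_mono (tmax g) (Ustar g) (L m w) alpha <= tstar.+1)%N}.
Proof.
move=> tstar L; have [gamma gamma0 hp] := hii.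
have [alpha0 alpha1] := andP halpha.
have [UtU _] := hi g.
have [t1 tg] := andP (tmax_bounds g).
have sm j i : (0 < j <= tmax g)%N -> measurable [set q : Q | sigma g q j = i].
  by move=> /andP[j0 jt]; apply: sigma_measurable; rewrite j0 (leq_trans jt).
have cons a := ae_threshold_consistency log sm gamma0 (hp g) (Ustar g) (a := a).
split.
  have [t2|] := ltnP 1 (tmax g).
    have a01 : 0 < alpha / ((tmax g)%:R - 1) <= 1.
      have t10 : 1 <= (tmax g)%:R - 1 :> R by rewrite lerBrDr (ler_nat _ 2).
      have t0 : 0 < (tmax g)%:R - 1 :> R by exact: lt_le_trans t10.
      by rewrite divr_gt0//= ler_pdivrMr// mul1r ltW// (lt_le_trans alpha1).
    apply: filterS (cons _ a01) => w [c c0 H]; exists c => // m cm.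
    by apply: t_union_near_t_star => // [|t /(H m cm)[]|t /(H m cm)[]]//; exact: hiii.
  (* Here [tmax g = 1]: the level [alpha / (tmax - 1)] is a division by 0, but no [t] satisfies
     [0 < t < 1], so both requirements on the bound are vacuous. *)
  move=> t2; apply: aeW => w; exists 1 => // m _.
  apply: t_union_near_t_star => //; first exact: hiii.
  - by move=> t /andP[t0 tt]; lia.
  - by move=> t /andP[t0 tt]; lia.
have a01 : 0 < alpha <= 1 by rewrite alpha0 ltW.
apply: filterS (cons _ a01) => w [c c0 H]; exists c => // m cm.
by apply: t_mono_near_t_star => // [|t /(H m cm)[]|t /(H m cm)[]]//; exact: hiii.
Qed.
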